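(* Let $T$ be a Taimanov semigroup and let $S$ be a square-topological semigroup which satisfies the separation axiom $T_1$ and contains $T$ as a subsemigroup. Then $T$ is a closed subset of $S$.
   Context: A semigroup $T$ is called a Taimanov semigroup if it contains two distinct elements $0_T,\infty_T$ such that for any $x,y\in T$: $x\cdot y=\infty_T$ if $x\ne y$ and $x,y\in T\setminus\{0_T,\infty_T\}$; and $x\cdot y=0_T$ if $x=y$ or $\{x,y\}\cap\{0_T,\infty_T\}\neq\emptyset$. No finiteness or infiniteness of $T$ is assumed. A semitopological semigroup is a semigroup $S$ endowed with a topology such that for every $a\in S$ the shifts $S\to S$, $x\mapsto ax$, and $S\to S$, $x\mapsto xa$, are continuous (no separation axiom is included in this definition). A semitopological semigroup $S$ is called square-topological if the map $S\to S$, $x\mapsto x^2$, is continuous. The separation axiom $T_1$ means that all singletons are closed. ''$S$ contains $T$ as a subsemigroup'' is meant algebraically: $T\subset S$ and the operation of $T$ is the restriction of that of $S$; no topology on $T$ is prescribed in advance. *)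

(* Defs.v *)
From HB Require Import structures.
From mathcomp Require Import all_boot all_order.
From mathcomp Require Import boolp classical_sets topology.

Set Implicit Arguments.
Unset Strict Implicit.
Unset Printing Implicit Defensive.

Local Open Scope classical_set_scope.
Local Open Scope group_scope.

Definition taimanov (T : semigroupType) : Prop :=
  exists zero infty : T,
    [/\ zero <> infty,
        forall x y : T, x <> y ->
          (~` [set zero; infty]) x -> (~` [set zero; infty]) y ->
          x * y = infty
      & forall x y : T,
          x = y \/ [set x; y] `&` [set zero; infty] !=set0 ->
          x * y = zero].

(* No separation axiom is imposed, and the multiplication need not be jointly
   continuous. *)
HB.mixin Record isSemitopological S & Semigroup S & Topological S := {
  mulg_continuousr : forall a : S, continuous (fun x : S => a * x);
  mulg_continuousl : forall a : S, continuous (fun x : S => x * a)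
}.

#[short(type="semitopologicalSemigroupType")]
HB.structure Definition SemitopologicalSemigroup :=
  {S of isSemitopological S & Semigroup S & Topological S}.

HB.mixin Record isSquareTopological S & SemitopologicalSemigroup S := {
  square_continuous : continuous (fun x : S => x * x)
}.

#[short(type="squareTopologicalSemigroupType")]
HB.structure Definition SquareTopologicalSemigroup :=
  {S of isSquareTopological S & SemitopologicalSemigroup S}.

(* The library states T1 by separating distinct points with an open set. *)
Lemma accessible_spaceP (S : topologicalType) :
  accessible_space S <-> forall x : S, closed [set x].
Proof.
split=> [T1 x|cl x y xy]; first exact: accessible_closed_set1.
exists (~` [set y]); split; first exact/closed_openC/cl.
  by rewrite in_setE; exact/eqP.
by rewrite setCK in_setE.
Qed.

(* Main.v *)
(** A point [s] of the closure of [T] outside [T] is, by [T1], in the closure of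
    [T] minus any finite set. For [t] in [T] other than [0_T] and [oo_T], the
    shift by [t] is constantly [oo_T] on [T] minus [0_T], [oo_T], [t], so
    [t * s = oo_T]; hence the shift by [s] is constantly [oo_T] on [T] minus
    [0_T], [oo_T], and [s * s = oo_T]. But squaring is constantly [0_T] on [T],
    so [s * s = 0_T]. *)
Require Import Defs.
From HB Require Import structures.
From mathcomp Require Import all_boot all_order.
From mathcomp Require Import boolp classical_sets topology.

Set Implicit Arguments.
Unset Strict Implicit.
Unset Printing Implicit Defensive.

Local Open Scope classical_set_scope.

(** Any neighbourhood of [s], cut down by the open complement of [a], is still one and so meets
    [A]. *)
Lemma closure_setD1 (X : topologicalType) (A : set X) (a s : X) :
  closed [set a] -> s <> a -> closure A s -> closure (A `\ a) s.
Proof.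
move=> cla sa As B Bs.
have [x [Ax [Bx xa]]] : A `&` (B `&` ~` [set a]) !=set0.
  by apply: As; apply: filterI => //; apply: open_nbhs_nbhs; split=> //;
     exact: closed_openC.
by exists x.
Qed.

(** The fibre of [f] over [c] is closed and contains [A], hence also its closure. *)
Lemma continuous_closure_cst (X Y : topologicalType) (f : X -> Y) (A : set X)
    (c : Y) (s : X) :
  continuous f -> closed [set c] -> (forall x, A x -> f x = c) ->
  closure A s -> f s = c.
Proof.
move=> fC clc fA As.
have clf : closed (f @^-1` [set c]) by move/continuous_closedP: fC; exact.
by apply: clf; apply: closureS As.
Qed.

Theorem theorem1 (S : squareTopologicalSemigroupType) (D : {pred S})
    (T : subSemigroupType D) :
  taimanov T -> accessible_space S -> closed [set` D].
Proof.
move=> [z [o [zo mulo mulz]]] /accessible_closed_set1 cl1 s Ds /=.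
apply: contrapT => nDs.
have s_val (t : T) : s <> val t by move=> st; apply: nDs; rewrite st; exact: valP.
(* The Taimanov laws hold in [T], so points of [D] are lifted along [val]. *)
have val_surj x : [set` D] x -> exists t : T, x = val t.
  by move=> Dx; exists (Sub x Dx); rewrite SubK.
pose D0 := [set` D] `\ val z `\ val o.
have D0s : closure D0 s by apply: closure_setD1 => //; exact: closure_setD1.
have D0P x : D0 x -> exists2 t : T, x = val t & (~` [set z; o]) t.
  move=> [[/val_surj[t ->] tz] tO]; exists t => //.
  by move=> [te|te]; [apply: tz|apply: tO]; rewrite /= te.
have shift_s x : D0 x -> (x * s)%g = val o.
  move=> /D0P[t -> t0].
  (* Dropping [val t] keeps the two factors distinct, as [mulo] demands. *)
  have D0ts : closure (D0 `\ val t) s by exact: closure_setD1.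
  apply: (continuous_closure_cst (mulg_continuousr (val t)) (cl1 _)) D0ts.
  move=> _ [/D0P[u -> u0] /= ut]; rewrite -valM mulo // => tu.
  by apply: ut; rewrite tu.
have sso : (s * s)%g = val o
  by exact: continuous_closure_cst (mulg_continuousl s) (cl1 _) shift_s D0s.
have ssz : (s * s)%g = val z.
  (* All of [D] serves here: [mulz] covers every square. *)
  apply: (continuous_closure_cst square_continuous (cl1 _)) Ds => x.
  by move=> /val_surj[t ->]; rewrite -valM mulz //; left.
by apply/zo/val_inj; rewrite -ssz.
Qed.
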